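(* Let $\vartheta\in\{d,p\}$, let $N_{\vartheta}\geq 1$ be the dimension of the corresponding resource block, and let $K_{\vartheta}\geq 0$ be an integer (the Householder depth budget) satisfying $K_{\vartheta}\geq N_{\vartheta}-1$. Then every $N_{\vartheta}\times N_{\vartheta}$ complex unitary matrix $\mathbf{U}_{\vartheta}$ can be represented exactly by the Householder parameterization of depth $K_{\vartheta}$; that is, there exist nonzero vectors $\mathbf{v}_{\vartheta,1},\ldots,\mathbf{v}_{\vartheta,K_{\vartheta}}\in\mathbb{C}^{N_{\vartheta}\times 1}$ and phases $\theta_{\vartheta,1},\ldots,\theta_{\vartheta,N_{\vartheta}}\in\mathbb{R}$ such that $$\mathbf{U}_{\vartheta}=\mathbf{D}_{\vartheta}\,\mathbf{H}_{\vartheta,K_{\vartheta}}\cdots\mathbf{H}_{\vartheta,1},$$ where $\mathbf{D}_{\vartheta}=\operatorname{diag}(e^{j\theta_{\vartheta,1}},\ldots,e^{j\theta_{\vartheta,N_{\vartheta}}})$ and $\mathbf{H}_{\vartheta,i}=\mathbf{I}_{N_{\vartheta}}-2\,\dfrac{\mathbf{v}_{\vartheta,i}\mathbf{v}_{\vartheta,i}^{H}}{\mathbf{v}_{\vartheta,i}^{H}\mathbf{v}_{\vartheta,i}}$ for $i=1,\ldots,K_{\vartheta}$.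
   Context: Here $j=\sqrt{-1}$, $(\cdot)^H$ is the conjugate transpose, and $\mathbf{I}_{N_{\vartheta}}$ is the identity matrix. The index $\vartheta\in\{d,p\}$ only labels the data block ($d$) and the pilot block ($p$); $N_d$ and $N_p$ denote their dimensions (positive integers). When $K_{\vartheta}=0$, the product of reflections is defined to be $\mathbf{I}_{N_{\vartheta}}$, so that $\mathbf{U}_{\vartheta}=\mathbf{D}_{\vartheta}$. *)

(* Defs.v *)
From HB Require Import structures.
From mathcomp Require Import all_boot all_order all_algebra.
From mathcomp Require Import spectral sesquilinear.
From mathcomp Require Import reals trigo.
From mathcomp Require Export complex.

Set Implicit Arguments.
Unset Strict Implicit.
Unset Printing Implicit Defensive.

Import Order.TTheory GRing.Theory Num.Theory.
Local Open Scope ring_scope.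
Local Open Scope complex_scope.
Local Open Scope sesquilinear_scope.

(* The scalar v^H v is the unique entry of the 1 x 1 matrix v ^t* *m v. *)
Definition householder (C : numClosedFieldType) (n : nat) (v : 'cV[C]_n) : 'M[C]_n :=
  1%:M - (2 / (v ^t* *m v) 0 0) *: (v *m v ^t*).

(* H_K *m ... *m H_1, where H_i is the reflection of v (i - 1); the big operator
   multiplies from left to right, hence the reversal of the indices. *)
Definition householder_prod (C : numClosedFieldType) (n K : nat)
    (v : 'I_K -> 'cV[C]_n) : 'M[C]_n :=
  \big[mulmx/1%:M]_(i < K) householder (v (rev_ord i)).

(* e^(j t), given by Euler's formula because the libraries have no complex
   exponential. *)
Definition expj (R : realType) (t : R) : R[i] := cos t +i* sin t.

Definition phase_mx (R : realType) (n : nat) (t : 'I_n -> R) : 'M[R[i]]_n :=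
  diag_mx (\row_(k < n) expj (t k)).

(* Main.v *)
From HB Require Import structures.
Require Import Defs.
From mathcomp Require Import all_boot all_order all_algebra.
From mathcomp Require Import spectral reals complex.
From mathcomp Require Import sesquilinear trigo.

Import Order.TTheory GRing.Theory Num.Theory.

Local Open Scope ring_scope.
Local Open Scope sesquilinear_scope.

(** Clear the rows of U from the bottom up. If the rows below row m are already
    supported on the diagonal then, U being unitary, so are the corresponding
    columns; a reflection H sends row m to a multiple of e_m, and its vector
    vanishes below m, so U H keeps the lower rows. After N - 1 steps only row 0
    is left, which is then supported on the diagonal as well, so what remains
    is a unitary diagonal matrix. When K exceeds N - 1, the extra steps reflect
    the last row again. *)

Section Reflection.
Set Implicit Arguments.
Unset Strict Implicit.
Variables (C : numClosedFieldType) (n : nat).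
Implicit Types (u w : 'rV[C]_n) (v : 'cV[C]_n) (m : 'I_n).

Lemma trmxCD k l (A B : 'M[C]_(k, l)) : (A + B) ^t* = A ^t* + B ^t*.
Proof. by apply/matrixP => i j; rewrite !mxE rmorphD. Qed.

Lemma trmxCZ k l (a : C) (A : 'M[C]_(k, l)) : (a *: A) ^t* = a^* *: A ^t*.
Proof. by apply/matrixP => i j; rewrite !mxE rmorphM. Qed.

Lemma trmxC_mul k l q (A : 'M[C]_(k, l)) (B : 'M[C]_(l, q)) :
  (A *m B) ^t* = B ^t* *m A ^t*.
Proof. by rewrite trmx_mul map_mxM. Qed.

Lemma trmxC_delta k l (i : 'I_k) (j : 'I_l) :
  (delta_mx i j : 'M[C]_(k, l)) ^t* = delta_mx j i.
Proof. by apply/matrixP => a b; rewrite !mxE andbC conjC_nat. Qed.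

Lemma normsq_cV_eq0 v : ((v ^t* *m v) 0 0 == 0) = (v == 0).
Proof.
apply/idP/eqP => [|->]; last by rewrite mulmx0 mxE.
rewrite mxE psumr_eq0 => [/allP h|i _]; last by rewrite !mxE mulrC mul_conjC_ge0.
apply/matrixP => i j; rewrite ord1 mxE; apply/eqP.
by have := h i (mem_index_enum _); rewrite !mxE mulrC mul_conjC_eq0.
Qed.

Lemma householderC v : (householder v) ^t* = householder v.
Proof.
rewrite /householder -scaleNr trmxCD trmxCZ trmxC_mul trmxCK trmx1 map_mx1.
rewrite conj_Creal // rpredN rpred_div ?rpred_nat // mxE rpred_sum // => i _.
by rewrite !mxE mulrC ger0_real // mul_conjC_ge0.
Qed.

Lemma householderK v : v != 0 -> householder v *m householder v = 1%:M.
Proof.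
rewrite -normsq_cV_eq0 /householder; set s := (_ *m _) 0 0 => s0.
have P2 : (v *m v ^t*) *m (v *m v ^t*) = s *: (v *m v ^t*).
  by rewrite mulmxA -(mulmxA v) [v ^t* *m v]mx11_scalar mul_mx_scalar scalemxAl.
rewrite mulmxBl mul1mx mulmxBr mulmx1 -scalemxAl -scalemxAr P2 !scalerA.
have -> : 2 / s * (2 / s) * s = 2 / s + 2 / s.
  by rewrite -mulrA divfK // mulr_natr.
by rewrite scalerDl opprB addrK subrK.
Qed.

Lemma householder_unitary v : v != 0 -> householder v \is unitarymx.
Proof. by move=> v0; apply/unitarymxP; rewrite householderC householderK. Qed.

Lemma polar_phase (z : C) : exists p, p * p^* = 1 /\ z * p^* = `|z|.
Proof.
have [->|z0] := eqVneq z 0.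
  by exists 1; rewrite conjC1 mul1r mul0r normr0.
have nz : `|z| != 0 by rewrite normr_eq0.
exists (z / `|z|); have nc : `|z|^* = `|z| by rewrite conj_normC.
rewrite rmorphM /= fmorphV /= nc; split.
  by rewrite mulrACA -normCK -invfM -expr2 divff ?expf_neq0.
by rewrite mulrA -normCK expr2 mulfK.
Qed.

(* Of the two reflections sending [u] to a multiple of [e_m], this is the one
   whose vector cannot vanish, because no cancellation occurs in entry [m]. *)
Lemma householder_to_axis u m : u *m u ^t* = 1%:M ->
  exists v c, [/\ v != 0,
    forall i, i != m -> u 0 i = 0 -> v i 0 = 0 &
    u *m householder v = c *: delta_mx 0 m].
Proof.
move=> u1; have [p [pp up]] := polar_phase (u 0 m).
(* With [p] the phase of [u 0 m], entry [m] of [w] is [p] times [1 + |u 0 m|]. *)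
pose w := u + p *: delta_mx 0 m.
have uw : u *m w ^t* = (1 + `|u 0 m|)%:M.
  rewrite trmxCD trmxCZ trmxC_delta mulmxDr u1 -scalemxAr -colE.
  by rewrite [X in _ *: X]mx11_scalar !mxE scale_scalar_mx mulrC up -raddfD.
have dw : delta_mx 0 m *m w ^t* = ((u 0 m)^* + p^*)%:M :> 'M_1.
  by rewrite -rowE [LHS]mx11_scalar !mxE !eqxx mulr1 rmorphD.
have up' : p * (u 0 m)^* = `|u 0 m|.
  by rewrite -[RHS]conj_normC -up rmorphM /= conjCK mulrC.
have ww : w *m w ^t* = (2 * (1 + `|u 0 m|))%:M.
  rewrite {1}/w mulmxDl -scalemxAl uw dw scale_scalar_mx mulrDr up' pp -raddfD.
  by rewrite mulr_natl mulr2n [X in _ + X]addrC.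
have nz : 1 + `|u 0 m| != 0 by rewrite gt_eqF // ltr_pwDl.
(* Since [w w^H] is twice [u w^H], the reflection sends [u] to [u - w], which is [- p] times
   [e_m]. *)
exists (w ^t*), (- p); split.
- by rewrite -normsq_cV_eq0 trmxCK ww mxE mulf_neq0 ?pnatr_eq0.
- by move=> i im ui; rewrite !mxE ui (negbTE im) mulr0 addr0 conjC0.
rewrite /householder trmxCK ww mxE eqxx mulr1n mulmxBr mulmx1 -scalemxAr mulmxA.
rewrite uw mul_scalar_mx scalerA invfM mulrA divff ?pnatr_eq0 // mul1r mulVf //.
by rewrite scale1r opprD addrA subrr add0r scaleNr.
Qed.

End Reflection.

Section Elimination.
Set Implicit Arguments.
Unset Strict Implicit.
Variables (C : numClosedFieldType).

Definition diag_from n (m : nat) (U : 'M[C]_n) :=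
  forall i j : 'I_n, (m <= i)%N -> j != i -> U i j = 0.

(** Row [j] has only its diagonal entry, which is nonzero because the row has norm 1; orthogonality
    of rows [i] and [j] then forces [U i j] to vanish. *)
Lemma diag_from_col n m (U : 'M[C]_n) : U \is unitarymx -> diag_from m U ->
  forall i j : 'I_n, (m <= j)%N -> j != i -> U i j = 0.
Proof.
move=> /unitarymxP UU dU i j mj ji; have Uj k : (U *m U ^t*) k j = U k j * (U j j)^*.
  rewrite mxE (bigD1 j) //= big1 ?addr0 ?mxE // => l lj.
  by rewrite !mxE (dU j l) // conjC0 mulr0.
have := Uj j; have := Uj i; rewrite UU !mxE eqxx eq_sym (negbTE ji).
move=> /esym/eqP; rewrite mulf_eq0 => /orP[/eqP //|/eqP ->].
by rewrite mulr0 => /eqP; rewrite oner_eq0.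
Qed.

Lemma diag_from_step n m (U : 'M[C]_n.+1) : U \is unitarymx ->
  diag_from m.+1 U ->
  exists2 v, v != 0 & diag_from m (U *m householder v).
Proof.
(* The minimum keeps [r] a valid index; if [m] exceeds [n], the conclusion is vacuous and any
   reflection will do. *)
move=> Uu dU; pose r : 'I_n.+1 := inord (minn m n).
have rE : r = minn m n :> nat by rewrite inordK // ltnS geq_minr.
have above (i : 'I_n.+1) : (m <= i)%N -> i != r -> (m < i)%N.
  move=> mi; rewrite -val_eqE /= rE (minn_idPl (leq_trans mi (leq_ord i))).
  by rewrite ltn_neqAle eq_sym mi andbT.
have u1 : row r U *m (row r U) ^t* = 1%:M.
  have /unitarymxP/matrixP/(_ r r) := Uu; rewrite !mxE eqxx => rr.
  apply/matrixP => i j; rewrite !ord1 !mxE -[RHS]rr.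
  by apply: eq_bigr => k _; rewrite !mxE.
have [v [c [v0 vz uH]]] := @householder_to_axis _ _ (row r U) r u1.
exists v => // i j mi ji; have [ir|ir] := eqVneq i r.
  have := congr1 (fun M : 'rV_n.+1 => M 0 j) uH.
  by rewrite -row_mul !mxE -ir (negbTE ji) andbF mulr0.
have mi' := above i mi ir.
(* Row [i] is supported at [i], where [v] vanishes because [U r i] does; hence the reflection fixes
   this row. *)
have Uv : row i U *m v = 0.
  apply/matrixP => a b; rewrite !mxE !ord1 big1 // => k _; rewrite mxE.
  have [->|ki] := eqVneq k i; last by rewrite dU ?mul0r.
  by rewrite vz ?mulr0 // mxE (diag_from_col Uu dU).
have : row i (U *m householder v) = row i U.
  by rewrite row_mul /householder mulmxBr mulmx1 -scalemxAr mulmxA Uv mul0mx scaler0 subr0.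
by move=> /(congr1 (fun M : 'rV_n.+1 => M 0 j)); rewrite !mxE => ->; rewrite dU.
Qed.

HB.instance Definition _ n :=
  Monoid.isLaw.Build 'M[C]_n 1%:M mulmx (@mulmxA C n n n n) (@mul1mx C n n)
    (@mulmx1 C n n).

(** Prepending [v0] to the family adds a factor on the right, because index 0 is the rightmost one
    in the reversed product. *)
Lemma householder_prodS n K (v0 : 'cV[C]_n) (v : 'I_K -> 'cV[C]_n) :
  householder_prod (fun i => oapp v v0 (unlift ord0 i)) =
  householder_prod v *m householder v0.
Proof.
rewrite /householder_prod big_ord_recr /=.
have -> : rev_ord ord_max = ord0 :> 'I_K.+1 by apply/val_inj; rewrite /= subnn.
rewrite unlift_none /=; congr (_ *m _); apply: eq_bigr => i _.
have -> : rev_ord (widen_ord (leqnSn K) i) = lift ord0 (rev_ord i).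
  by apply/val_inj; rewrite /= /bump /= add1n subSS subnSK.
by rewrite liftK.
Qed.

Lemma unitary_householder_prod n K (U : 'M[C]_n.+1) : U \is unitarymx ->
  diag_from K.+1 U ->
  exists (v : 'I_K -> 'cV[C]_n.+1) (D : 'M[C]_n.+1),
    [/\ forall i, v i != 0, D \is unitarymx, is_diag_mx D &
        U = D *m householder_prod v].
Proof.
elim: K U => [|K IH] U Uu dU.
  exists (fun=> 0), U; split=> //; first by case.
    apply/is_diag_mxP => i j ij; case: (posnP i) => [i0|i0].
      (* Row 0 needs no reflection: its off-diagonal entries lie in columns that are already
         cleared. *)
      apply: (diag_from_col Uu dU); last by rewrite -val_eqE eq_sym.
      by rewrite lt0n -i0 eq_sym.
    by apply: dU; rewrite // -val_eqE eq_sym.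
  by rewrite /householder_prod big_ord0 mulmx1.
have [v0 v0n dUH] := diag_from_step Uu dU.
have [|v [D [vn Du Dd UD]]] := IH (U *m householder v0) _ dUH.
  by rewrite mul_unitarymx ?householder_unitary.
exists (fun i => oapp v v0 (unlift ord0 i)), D; split=> //.
  by move=> i; case: unliftP => [j|] _ /=.
(* The reflection is an involution, so multiplying by it again recovers [U]. *)
by rewrite householder_prodS mulmxA -UD -mulmxA householderK ?mulmx1.
Qed.

End Elimination.

Local Open Scope complex_scope.

Lemma expj_surj (R : realType) (z : R[i]) : z * z^*%C = 1 -> exists t, z = expj t.
Proof.
case: z => x y /eqP; rewrite eq_complex /= => /andP[/eqP]; rewrite mulrN opprK.
rewrite -!expr2 => xy _.
have y2 : 1 - x ^+ 2 = y ^+ 2 by rewrite -xy addrC addKr.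
have x1 : -1 <= x <= 1.
  by rewrite -ler_norml -(@expr_le1 _ 2) // real_normK ?num_real // -subr_ge0 y2 sqr_ge0.
have sE : sin (acos x) = `|y| by rewrite sin_acos // y2 sqrtr_sqr.
(* The angle [acos x] gives the right cosine and the sine up to sign; the sign of [y] selects the
   angle or its opposite. *)
have [y0|y0] := lerP 0 y.
  by exists (acos x); rewrite /expj acosK // sE ger0_norm.
by exists (- acos x); rewrite /expj cosN sinN acosK // sE ltr0_norm // opprK.
Qed.

Theorem lemma1 (R : realType) (N K : nat) (hN : (1 <= N)%N)
    (hK : (N - 1 <= K)%N) (U : 'M[R[i]]_N) (hU : U \is unitarymx) :
  exists (v : 'I_K -> 'cV[R[i]]_N) (theta : 'I_N -> R),
    (forall i : 'I_K, v i != 0) /\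
    U = phase_mx theta *m householder_prod v.
Proof.
case: N hN hK U hU => // n _; rewrite subn1 /= => nK U Uu.
have [|v [D [v0 Du /diag_mxP [d Dd] ->]]] := @unitary_householder_prod _ n K U Uu.
  (* The depth bound enters here: no row has index above [K], so the starting condition is
     vacuous. *)
  by move=> i j /leq_trans/(_ (leq_ord i)); rewrite ltnNge nK.
have /fin_all_exists [t tE] (k : 'I_n.+1) : exists t, d 0 k = expj t.
  (* The diagonal entries of [D D^H = 1] say that each [d 0 k] has modulus 1. *)
  apply: expj_surj; have /unitarymxP/matrixP/(_ k k) := Du.
  rewrite Dd mxE (bigD1 k) //= big1 => [|j jk].
    by rewrite !mxE eqxx addr0.
  by rewrite !mxE eq_sym (negbTE jk) mul0r.
exists v, t; split=> //; congr (_ *m _).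
by rewrite Dd /phase_mx; congr diag_mx; apply/rowP => k; rewrite mxE.
Qed.
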